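(* Let $(\Omega,\mathcal{F},\mathbf{P})$ be a probability space, let $A_t(\omega)=A(t,\omega)$, $t\ge 0$, be a random nondecreasing right-continuous function of $t$ with $A(0)=0$ and $A(\infty)=1$, and let $\{\mathcal{F}_t\}_{t\ge 0}$ be an increasing, right-continuous family of sub-$\sigma$-fields of $\mathcal{F}$. Let $\{A^p_t\}$ be the dual previsible projection of $\{A_t\}$ with respect to $\{\mathcal{F}_t\}$, and let $R=A^p_\infty$. Then $R\preceq\mathcal{E}$, where $\mathcal{E}$ denotes an exponential random variable of mean one.
   Context: For real random variables $X,Y$, one writes $Y\preceq X$ if and only if $\mathbf{E}\,\phi(Y)\le \mathbf{E}\,\phi(X)$ for every convex function $\phi:\mathbb{R}\to\mathbb{R}$, where both expectations are allowed to be infinite. The process $\{A_t\}$ is not assumed to be adapted to $\{\mathcal{F}_t\}$; each $A_t$ is just an $\mathcal{F}$-measurable random variable. Values at infinity are limits: $A(\infty)=\lim_{t\to\infty}A_t$ and $A^p_\infty=\lim_{t\to\infty}A^p_t$. The dual previsible (predictable) projection $\{A^p_t\}$ of $\{A_t\}$ is the $\{\mathcal{F}_t\}$-previsible, nondecreasing, right-continuous process with $A^p_0=0$, unique up to indistinguishability, such that $\mathbf{E}\int_{(0,\infty)} H_t\,dA^p_t=\mathbf{E}\int_{(0,\infty)} H_t\,dA_t$ for every bounded $\{\mathcal{F}_t\}$-previsible process $H$. (Previsible means measurable with respect to the $\sigma$-field on $(0,\infty)\times\Omega$ generated by the left-continuous adapted processes.) *)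

(* Defs.v *)
From HB Require Import structures.
From mathcomp Require Import all_boot all_order all_algebra.
From mathcomp Require Import all_classical all_reals all_analysis.

Set Implicit Arguments.
Unset Strict Implicit.
Unset Printing Implicit Defensive.

Import Order.TTheory GRing.Theory Num.Theory.
Import numFieldNormedType.Exports.

Local Open Scope classical_set_scope.
Local Open Scope ring_scope.

(* Processes are functions X : R -> Omega -> R (time first).  The time axis is
   [0, +oo[: values at negative times are never constrained nor used. *)

Section stieltjes.
Context {R : realType}.

Definition increasing_path (f : R -> R) : Prop :=
  [/\ f 0 = 0,
      (forall s t : R, 0 <= s -> s <= t -> f s <= f t) &
      (forall t : R, 0 <= t -> f x @[x --> t^'+] --> f t)].

Definition freeze (f : R -> R) : R -> R := fun t => f (Num.max 0 t).

Lemma freeze_nondecreasing (f : R -> R) :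
  increasing_path f -> nondecreasing (freeze f).
Proof.
move=> [_ fnd _] s t st; rewrite /freeze; apply: fnd.
  by rewrite le_max lexx.
by rewrite ge_max !le_max lexx st orbT.
Qed.

Lemma freeze_right_continuous (f : R -> R) :
  increasing_path f -> right_continuous (freeze f).
Proof.
move=> [_ _ frc] t; rewrite /freeze; have [t0|t0] := leP 0 t.
  apply: cvg_trans (frc t t0); apply: near_eq_cvg.
  near=> x; rewrite max_r//; apply: ltW; apply: le_lt_trans t0 _.
  by near: x; exact: nbhs_right_gt.
apply: cvg_near_cst; near=> x; apply/eqP; rewrite max_l//.
by near: x; exact: nbhs_right_le.
Unshelve. all: by end_near. Qed.

Definition cumulative_of (f : R -> R) (fP : increasing_path f) :
    cumulative R R :=
  HB.pack (freeze f)
    (isCumulative.Build R _ R (freeze f)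
       (freeze_nondecreasing fP) (freeze_right_continuous fP)).

(* The measure df, with df ]s, t] = f t - f s for 0 <= s <= t; it is null on
   the negative half-line.  If f is not an increasing path, df is 0 by
   convention. *)
Definition stieltjes (f : R -> R) :
    {measure set (measurableTypeR R) -> \bar R} :=
  if pselect (increasing_path f) is left fP
  then lebesgue_stieltjes_measure (cumulative_of fP)
  else mzero.

End stieltjes.

Section processes.
Context {R : realType} {d : measure_display} {Omega : measurableType d}.
Implicit Types (F : R -> set (set Omega)) (X H : R -> Omega -> R).

Definition right_continuous_filtration F : Prop :=
  [/\ (forall t : R, 0 <= t -> sigma_algebra setT (F t)),
      (forall t : R, 0 <= t -> F t `<=` measurable),
      (forall s t : R, 0 <= s -> s <= t -> F s `<=` F t) &
      (forall t : R, 0 <= t -> F t = \bigcap_(s in `]t, +oo[) F s)].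

Definition adapted F X : Prop :=
  forall t : R, 0 < t -> preimage_set_system setT (X t) measurable `<=` F t.

Definition left_continuous_process X : Prop :=
  forall w (t : R), 0 < t -> X s w @[s --> t^'-] --> X t w.

Definition domain : set (R * Omega) := `]0, +oo[ `*` setT.

Definition domain_system X : set (set (R * Omega)) :=
  preimage_set_system domain (fun tw => X tw.1 tw.2) measurable.

Definition previsible_sigma_field F : set (set (R * Omega)) :=
  <<s domain,
    \bigcup_(X in [set X | adapted F X /\ left_continuous_process X])
      domain_system X >>.

Definition previsible F X : Prop :=
  domain_system X `<=` previsible_sigma_field F.

Definition bounded_process X : Prop :=
  exists M : R, forall (t : R) w, 0 < t -> `|X t w| <= M.

Definition mean_integral (P : probability Omega R) H X : \bar R :=
  (\int[P]_w \int[stieltjes (X ^~ w)]_(t in `]0%R, +oo[) (H t w)%:E)%E.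

(* Ap is one version of the dual previsible projection of A, which is only
   determined up to indistinguishability.  The path properties are required
   almost surely: no completeness is assumed of the filtration, and then there
   need not be a previsible version all of whose paths are finite-valued and
   increasing: for A t = 1_{tau <= t} with tau the identity of [0, 1] under the
   uniform law, and the natural filtration of A, every version has
   Ap t 1 = - ln (1 - t) for t < 1. *)
Definition dual_previsible_projection
    (P : probability Omega R) F (A Ap : R -> Omega -> R) : Prop :=
  [/\ previsible F Ap,
      {ae P, forall w, increasing_path (Ap ^~ w)} &
      (forall H, previsible F H -> bounded_process H ->
        mean_integral P H Ap = mean_integral P H A)].

(* X_oo = lim_(t -> +oo) X_t, with the convention of lim (a default value) at
   the points w where there is no finite limit. *)
Definition terminal_value X : Omega -> R :=
  fun w => lim (X t w @[t --> +oo]).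

End processes.

Local Open Scope ereal_scope.

(* Y is dominated by X in the convex order; the variables may live on different
   probability spaces.  A convex function has an affine minorant, so both
   expectations are well defined in ]-oo, +oo] for integrable X and Y. *)
Definition convex_dominated {R : realType}
    {d d' : measure_display} {T : measurableType d} {T' : measurableType d'}
    (P : probability T R) (Y : T -> R) (Q : probability T' R) (X : T' -> R) :
    Prop :=
  forall phi : R -> R, convex_function (setT : set R^o) phi ->
    'E_P[phi \o Y] <= 'E_Q[phi \o X].

Definition exponential_mean_one {R : realType}
    {d : measure_display} {T : measurableType d}
    (Q : probability T R) (X : {RV Q >-> R}) : Prop :=
  forall B : set R, measurable B -> distribution Q X B = exponential_prob 1%R B.

(* Main.v *)
From HB Require Import structures.
Require Import Defs.
From mathcomp Require Import all_boot all_order all_algebra.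
From mathcomp Require Import all_classical all_reals all_analysis.
From mathcomp Require Import measurable_realfun ring lra.
Import Order.TTheory GRing.Theory Num.Theory.
Import numFieldNormedType.Exports.
Local Open Scope classical_set_scope.
Local Open Scope ring_scope.

(** For a >= 0 the process H = 1_{Ap > a} is bounded and previsible.  Along a
    path, {t | Ap_t > a} is an interval of the form [tau, +oo[ or ]tau, +oo[, so
    that (R - a)^+ <= int H dAp, while int H dA <= 1_{R > a} because A has total
    mass 1.  Hence G a = E (R - a)^+ satisfies G a <= P (R > a).  Since
    e 1_{x > a + e} <= (x - a)^+ - (x - a - e)^+, this gives
    (1 + e) G (a + e) <= G a, and iterating with e = a / n yields
    G a <= exp (- a) G 0, where G 0 = E R = 1 (take H = 1).  The right-hand side
    is the value of G for an exponential variable, and the means agree;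
    approximating a convex function on [0, +oo[ from below by sums of an affine
    function and nonnegative multiples of calls (x - a)^+ gives the general
    case by Fatou's lemma. *)

(** * Almost everywhere comparison of integrals *)

Section ae_integral.
Context d (T : measurableType d) (R : realType).
Variable mu : {measure set T -> \bar R}.
Local Open Scope ereal_scope.
Import HBNNSimple.

(* No measurability is needed: the integral of a nonnegative function is a
   supremum over simple functions below it, and these can be set to 0 on a null
   set.  The terminal value of a previsible process and the inner integrals in
   mean_integral are only well behaved almost surely. *)
Lemma ge0_ae_le_integral_nonmeasurable (f g : T -> \bar R) :
  (forall x, 0 <= f x) -> (forall x, 0 <= g x) ->
  {ae mu, forall x, f x <= g x} -> \int[mu]_x f x <= \int[mu]_x g x.
Proof.
move=> f0 g0 [N [mN N0 fgN]]; rewrite (ge0_integralTE mu f0) (ge0_integralTE mu g0).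
apply: ge_ereal_sup => _ [h hf <-].
have mD := measurableC mN.
pose h' := proj_nnsfun h mD.
apply: ereal_sup_ubound; exists h' => [x|].
  rewrite /= mindicE; have [xN|xN] := boolP (x \in ~` N).
    rewrite mulr1; apply: le_trans (hf x) _; apply: contrapT => fgx.
    by move: xN; rewrite inE; apply; apply: fgN.
  by rewrite mulr0.
rewrite -!integralT_nnsfun; apply: ge0_ae_eq_integral => //.
- by apply/measurable_EFinP; exact: measurable_funPT.
- by apply/measurable_EFinP; exact: measurable_funPT.
- by move=> x _; rewrite lee_fin.
- by move=> x _; rewrite lee_fin.
exists N; split => // x /= hx; apply: contrapT => xN; apply: hx => _.
by rewrite /= mindicE mem_set// mulr1.
Qed.

Lemma ge0_ae_eq_integral_nonmeasurable (f g : T -> \bar R) :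
  (forall x, 0 <= f x) -> (forall x, 0 <= g x) ->
  {ae mu, forall x, f x = g x} -> \int[mu]_x f x = \int[mu]_x g x.
Proof.
move=> f0 g0 fg; apply/eqP; rewrite eq_le.
by apply/andP; split; apply: ge0_ae_le_integral_nonmeasurable => //;
  apply: filterS fg => x ->.
Qed.

Lemma ae_eq_integral_nonmeasurable (f g : T -> \bar R) :
  {ae mu, forall x, f x = g x} -> \int[mu]_x f x = \int[mu]_x g x.
Proof.
move=> fg; rewrite integralE [RHS]integralE.
congr (_ - _); apply: ge0_ae_eq_integral_nonmeasurable => //;
  by apply: filterS fg => x fgx; rewrite ?funeposE ?funenegE fgx.
Qed.

End ae_integral.

(** * Stieltjes measures and limits of increasing paths *)

Section stieltjes_paths.
Context {R : realType}.
Implicit Type f : R -> R.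

Lemma stieltjes_itv_oc f s t : increasing_path f -> 0 <= s -> s <= t ->
  stieltjes f `]s, t]%classic = (f t - f s)%:E.
Proof.
move=> fP s0 st; rewrite /stieltjes; case: pselect => // fP'.
rewrite /= /lebesgue_stieltjes_measure /measure_extension.
rewrite measurable_mu_extE/=; last exact: is_ocitv.
by rewrite wlength_itv_bnd//= /freeze !max_r// (le_trans s0).
Qed.

(** Continuity from below along the intervals ]0, n + 1]. The times start at 1 because the sections
    of a previsible process are only controlled at positive times. *)
Lemma stieltjes_itv_oy f : increasing_path f ->
  (f n.+1%:R)%:E @[n --> \oo] --> stieltjes f `]0, +oo[%classic.
Proof.
move=> fP; have f0 : f 0 = 0 by case: fP.
rewrite (_ : `]0, +oo[%classic = \bigcup_n `]0, n.+1%:R : R]%classic); last first.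
  apply/seteqP; split => [t|t [n _]] /=; rewrite !in_itv/=.
    rewrite andbT => t0; exists (Num.truncn t) => //=.
    by rewrite in_itv/= t0 ltW// truncnS_gt.
  by case/andP => ->.
rewrite (_ : (fun n => (f n.+1%:R)%:E) =
    stieltjes f \o (fun n => `]0, n.+1%:R : R]%classic)).
  2: by apply/funext => n /=; rewrite stieltjes_itv_oc// f0 subr0.
apply: nondecreasing_cvg_mu => //.
- by apply: bigcup_measurable => n _; exact: measurable_itv.
- move=> m n mn; apply/subsetPset => t /=; rewrite !in_itv/= => /andP[-> /le_trans].
  by apply; rewrite ler_nat.
Qed.

(** By monotonicity the set is closed upwards in the half-line; being an interval, it is Borel. *)
Lemma is_interval_superlevel f a : increasing_path f ->
  is_interval ([set t : R | a < f t] `&` `]0, +oo[%classic).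
Proof.
move=> [_ fnd _] s t /= [fs s0] _ u /andP[su _].
move: s0; rewrite /= !in_itv/= !andbT => s0.
have u0 := lt_le_trans s0 su; split => //.
by apply: lt_le_trans fs _; apply: fnd => //; exact: ltW.
Qed.

Lemma measurable_superlevel f a : increasing_path f ->
  measurable ([set t : measurableTypeR R | a < f t] `&` `]0, +oo[%classic).
Proof. by move=> /is_interval_superlevel/is_interval_measurable; exact. Qed.

(* With tau the infimum of [f > a], the superlevel set contains ]tau, T] if
   f tau <= a, and otherwise it contains [tau, T], the limit from above of
   ]s, T] for s < tau, where f s <= a. *)
Lemma stieltjes_superlevel f a T : increasing_path f -> 0 <= a ->
  0 <= T ->
  ((f T - a)%:E <=
    stieltjes f ([set t : measurableTypeR R | (a < f t)%R] `&` `]0%R, +oo[%classic))%E.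
Proof.
move=> fP a0 T0; have [f0 fnd _] := fP.
set S := _ `&` _; have mS : measurable S by exact: measurable_superlevel.
have [fTa|afT] := leP (f T) a.
  by apply: le_trans (measure_ge0 _ _); rewrite lee_fin subr_le0.
have Tgt0 : 0 < T.
  by rewrite lt_neqAle T0 andbT; apply/eqP => T0'; move: afT; rewrite -T0' f0 ltNge a0.
have ST : S T by split => //=; rewrite in_itv/= Tgt0.
have S0 : S !=set0 by exists T.
have Slb : lbound S 0 by move=> t [_]; rewrite /= in_itv/= andbT => /ltW.
have hS : has_inf S by split => //; exists 0.
pose tau := inf S.
have tau0 : 0 <= tau by apply: lb_le_inf.
have tauT : tau <= T by apply: ge_inf => //; exists 0.
have Sgt t : tau < t -> S t.
  move=> /(inf_lt S0)[s [afs s0] st]; move: s0; rewrite /= in_itv/= andbT => s0.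
  split => /=; last by rewrite in_itv/= (lt_trans s0).
  by apply: lt_le_trans afs (fnd _ _ _ _); exact: ltW.
have Slt s : 0 <= s -> s < tau -> f s <= a.
  move=> s0 stau; rewrite leNgt; apply/negP => afs.
  have : tau <= s.
    apply: ge_inf; first by exists 0.
    split => //=; rewrite in_itv/= andbT lt_neqAle s0 andbT; apply/eqP => s0'.
    by move: afs; rewrite -s0' f0 ltNge a0.
  by rewrite leNgt stau.
have [ftau|ftau] := leP (f tau) a.
  apply: (@le_trans _ _ (stieltjes f `]tau, T]%classic)).
    by rewrite stieltjes_itv_oc// lee_fin lerB.
  apply: le_measure; rewrite ?inE//.
  by move=> t /=; rewrite in_itv/= => /andP[/Sgt].
have taugt0 : 0 < tau.
  by rewrite lt_neqAle tau0 andbT; apply/eqP => t0'; move: ftau; rewrite -t0' f0 ltNge a0.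
(* The sequence starts at 0 and increases to [tau] from strictly below, so the length formula
   applies to each ]s n, T]. *)
pose s n : R := tau - tau / n.+1%:R.
have s0 n : 0 <= s n.
  by rewrite subr_ge0 ler_pdivrMr// ler_peMr// ler1n.
have stau n : s n < tau by rewrite ltrBlDr ltrDl divr_gt0.
have mI n : measurable (`]s n, T]%classic : set (measurableTypeR R)).
  exact: measurable_itv.
have capS : \bigcap_n (`]s n, T]%classic : set (measurableTypeR R)) `<=` S.
  move=> t tI; have tT : t <= T by have := tI 0%N I; rewrite /= in_itv/= => /andP[].
  have : tau <= t.
    rewrite leNgt; apply/negP => ttau.
    (* This choice gives tau / (n + 1) < tau - t, which puts t below [s n]. *)
    have [n nt] : exists n : nat, tau / (tau - t) < n.+1%:R.
      by exists (Num.truncn (tau / (tau - t))); exact: truncnS_gt.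
    have := tI n I; rewrite /= in_itv/= => /andP[+ _]; apply/negP; rewrite -leNgt.
    rewrite lerBrDr -lerBrDl ler_pdivrMr// mulrC -ler_pdivrMr ?subr_gt0//.
    exact: ltW.
  rewrite le_eqVlt => /predU1P[<-|/Sgt//].
  by split => //=; rewrite in_itv/= taugt0.
apply: (@le_trans _ _
    (stieltjes f (\bigcap_n (`]s n, T]%classic : set (measurableTypeR R))))).
  have cv : stieltjes f `]s n, T]%classic @[n --> \oo] -->
      stieltjes f (\bigcap_n (`]s n, T]%classic : set (measurableTypeR R))).
    apply: nonincreasing_cvg_mu => //.
    - rewrite stieltjes_itv_oc// ?ltry//; exact: ltW (lt_le_trans (stau _) tauT).
    - by apply: bigcap_measurable => //; exists 0%N.
    - move=> m n mn; apply/subsetPset => t /=; rewrite !in_itv/= => /andP[+ ->].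
      rewrite andbT; apply: le_lt_trans; rewrite lerB// ler_wpM2l//.
      by rewrite lef_pV2 ?posrE// ler_nat.
  rewrite -(cvg_lim _ cv)//; apply: lime_ge; first exact: cvgP cv.
  apply: nearW => n.
  rewrite stieltjes_itv_oc//; last exact: ltW (lt_le_trans (stau _) tauT).
  by rewrite lee_fin lerB// Slt.
apply: le_measure; rewrite ?inE//.
by apply: bigcap_measurable => //; exists 0%N.
Qed.

(** The measure is arbitrary because superlevel sets of a path of [Ap] are measured both by that
    path and by the path of [A]. *)
Lemma integral_superlevel (mu : {measure set (measurableTypeR R) -> \bar R}) f a :
  increasing_path f ->
  (\int[mu]_(t in `]0%R, +oo[) (\1_(`]a, +oo[%classic : set R) (f t))%:E =
   mu ([set t : measurableTypeR R | (a < f t)%R] `&` `]0%R, +oo[%classic))%E.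
Proof.
move=> fP; have mS := measurable_superlevel f a fP.
rewrite -[X in mu X](setIidl (@subIsetr _ _ _)) -integral_indic//.
apply: eq_integral => t; rewrite inE => t0; congr (_%:E).
rewrite !indicE; congr ((nat_of_bool _)%:R).
apply/idP/idP; rewrite !inE/= !in_itv/= !andbT.
  by move: t0; rewrite /= in_itv/= andbT.
by case.
Qed.

(* The absolute values make path_sup nonnegative, and measurable in a parameter,
   without any hypothesis on the path. *)
Definition path_sup f : \bar R := esups (fun n => `|f n.+1%:R|%:E) 0%N.

Lemma path_sup_ge0 f : (0 <= path_sup f)%E.
Proof.
apply: (@le_trans _ _ `|f 1|%:E); first by rewrite lee_fin.
by apply: ereal_sup_ubound; exists 0%N.
Qed.

Lemma path_ge0 f t : increasing_path f -> 0 <= t -> 0 <= f t.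
Proof. by move=> [f0 fnd _] t0; rewrite -f0 fnd. Qed.

(** Both sides are the limit of [f n.+1%:R], by continuity from below and by monotonicity; the
    absolute values disappear on an increasing path. *)
Lemma stieltjes_path_sup f : increasing_path f ->
  stieltjes f `]0, +oo[%classic = path_sup f.
Proof.
move=> fP; have [_ fnd _] := fP.
apply: cvg_unique (stieltjes_itv_oy f fP) _ => //.
have -> : path_sup f = ereal_sup (range (fun n => (f n.+1%:R)%:E)).
  congr ereal_sup; apply/seteqP; split => _ [n _ <-]; exists n => //;
    by rewrite ger0_norm// path_ge0.
apply: ereal_nondecreasing_cvgn => m n mn.
by rewrite lee_fin fnd// ler_nat ltnS.
Qed.

Lemma path_sup_ub f t : increasing_path f -> 0 <= t -> ((f t)%:E <= path_sup f)%E.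
Proof.
move=> fP t0; have [_ fnd _] := fP.
apply: (@le_trans _ _ `|f (Num.truncn t).+1%:R|%:E).
  rewrite lee_fin; apply: le_trans (ler_norm _).
  by rewrite fnd// ltW// truncnS_gt.
by apply: ereal_sup_ubound; exists (Num.truncn t).
Qed.

(** The bound on f T - a passes to the supremum over T; [a] stays on the right so that nothing is
    subtracted from a possibly infinite value. *)
Lemma path_sup_le_superlevel f a : increasing_path f -> 0 <= a ->
  (path_sup f <=
    stieltjes f ([set t : measurableTypeR R | (a < f t)%R] `&` `]0%R, +oo[%classic)
    + a%:E)%E.
Proof.
move=> fP a0; apply: ge_ereal_sup => _ [n _ <-].
have := stieltjes_superlevel f a n.+1%:R fP a0 (ler0n _ _).
by rewrite ger0_norm ?(path_ge0 f _ fP)// EFinB leeBlDr.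
Qed.

Lemma cvg_path_sup f : increasing_path f -> (path_sup f < +oo)%E ->
  f t @[t --> +oo] --> fine (path_sup f).
Proof.
move=> fP foo; have [_ fnd _] := fP.
have ffin : path_sup f \is a fin_num by rewrite ge0_fin_numE// path_sup_ge0.
apply/cvgrPdist_le => e e0.
have /ereal_sup_gt[_ [n _ <-]] : (path_sup f - e%:E < path_sup f)%E.
  by rewrite lteBlDr// lteDl// lte_fin.
rewrite -(fineK ffin) -EFinB lte_fin ger0_norm ?(path_ge0 f _ fP)// => fn.
near=> t; have nt : n.+1%:R <= t by near: t; exact: nbhs_pinfty_ge.
have ft : f t <= fine (path_sup f).
  by rewrite -lee_fin fineK// path_sup_ub// (le_trans _ nt).
rewrite ger0_norm ?subr_ge0// lerBlDr -lerBlDl (le_trans (ltW fn))//.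
exact: fnd.
Unshelve. all: by end_near. Qed.

End stieltjes_paths.

(** * Previsible processes: Borel images and fixed-time sections *)

Section previsible_processes.
Context {R : realType} {d : measure_display} {Omega : measurableType d}.
Variable F : R -> set (set Omega).

(** Supplies the two test processes built from [Ap]: the constant 1 and the indicator of Ap > a. *)
Lemma previsible_comp (X : R -> Omega -> R) (h : R -> R) :
  measurable_fun setT h -> previsible F X -> previsible F (fun t w => h (X t w)).
Proof.
move=> mh FX; apply: subset_trans FX.
exact: (@preimage_set_system_compS _ _ _ _ _ h (fun tw : R * Omega => X tw.1 tw.2)).
Qed.

(** The sets whose section at time [t] is measurable form a sigma-algebra on the domain, and it
    contains the generators because these come from adapted processes. *)
Lemma previsible_measurable (X : R -> Omega -> R) t :
  F t `<=` measurable -> previsible F X -> 0 < t ->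
  measurable_fun setT (X t).
Proof.
move=> Fm FX t0 _ B mB; rewrite setTI.
have domt w : domain (t, w) by split => //=; rewrite in_itv/= t0.
pose section_measurable (S : set (R * Omega)) := measurable [set w | S (t, w)].
have salg : sigma_algebra domain section_measurable.
  split => [|S mS|S mS]; rewrite /section_measurable.
  - exact: measurable0.
  - rewrite [X in measurable X](_ : _ = ~` [set w | S (t, w)]); first exact: measurableC.
    by apply/seteqP; split => [w [_]//|w]; split.
  - rewrite [X in measurable X](_ : _ = \bigcup_k [set w | S k (t, w)]).
      exact: bigcupT_measurable.
    by apply/seteqP; split => w [k _] Sk; exists k.
have gen : \bigcup_(Y in [set Y | adapted F Y /\ left_continuous_process Y])
    domain_system Y `<=` section_measurable.
  move=> _ [Y [adY _] [C mC <-]]; apply: Fm; apply: (adY t t0); exists C => //.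
  by apply/seteqP; split => [w [_ ?]|w [_ ?]]; split.
have /FX/(smallest_sub salg gen) : domain_system X
    (domain `&` (fun tw : R * Omega => X tw.1 tw.2) @^-1` B) by exists B.
rewrite /section_measurable; congr (measurable _).
by apply/seteqP; split => [w [_ ?]|w ?].
Qed.

End previsible_processes.

(** * Calls on an exponential variable *)

Section exponential_calls.
Context {R : realType}.

Lemma integral_expRN (x : R) :
  (\int[lebesgue_measure]_(t in `[x, +oo[) (expR (- t))%:E = (expR (- x))%:E)%E.
Proof.
have cexpN : continuous (fun z : R => expR (- z)).
  by move=> z; apply: continuous_comp; [exact: opp_continuous|exact: continuous_expR].
rewrite (@ge0_continuous_FTC2y R (fun t => expR (- t)) (fun t => - expR (- t)) x 0)//.
- by rewrite EFinN oppeK add0e.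
- exact: continuous_subspaceT.
- by rewrite -oppr0; apply: cvgN; exact: cvgr_expR.
- by apply: cvgN; apply/cvg_at_right_filter; exact: cexpN.
- by move=> t _; rewrite derive1E derive_val mulrN1 opprK.
Qed.

Lemma measurable_expRN (D : set R) :
  measurable_fun D (fun t : R => (expR (- t))%:E).
Proof.
apply: measurable_funTS; apply/measurable_EFinP.
by apply: measurableT_comp; [exact: measurable_expR|exact: oppr_measurable].
Qed.

Lemma exponential_prob_tail (x : R) : 0 <= x ->
  exponential_prob 1 (`]x, +oo[%classic : set R) = (expR (- x))%:E.
Proof.
move=> x0; rewrite -integral_expRN -integral_itv_obnd_cbnd.
  apply: eq_integral => t; rewrite inE/= in_itv/= andbT => xt.
  by rewrite exponential_pdfE ?(le_trans x0 (ltW xt))// mul1r mulN1r.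
exact: measurable_expRN.
Qed.

Lemma ge0_expectation_tail d (T : measurableType d) (Q : probability T R) (X : T -> R) :
  measurable_fun setT X -> (forall w, 0 <= X w) ->
  ('E_Q[X] = \int[lebesgue_measure]_(r in `[0%R, +oo[) Q (X @^-1` `]r, +oo[))%E.
Proof.
move=> mX X0; pose Y : {RV Q >-> R} := HB.pack X (isMeasurableFun.Build _ _ _ _ _ mX).
exact: (ge0_expectation_ccdf (X := Y)).
Qed.

(** Memorylessness: for r >= 0 the call exceeds r exactly when X > a + r, which has probability exp
    (- a) exp (- r); the tail is then integrated over r. *)
Lemma exponential_call d (T : measurableType d) (Q : probability T R)
    (X : {RV Q >-> R}) (a : R) : exponential_mean_one X -> 0 <= a ->
  ('E_Q[fun w => Num.max (X w - a)%R 0%R] = (expR (- a))%:E)%E.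
Proof.
move=> EX a0.
rewrite ge0_expectation_tail; last 2 first.
- by apply: measurable_maxr => //; apply: measurable_funB.
- by move=> w; rewrite le_max lexx orbT.
transitivity (\int[lebesgue_measure]_(r in `[0%R, +oo[)
    ((expR (- a))%:E * (expR (- r))%:E))%E.
  apply: eq_integral => r; rewrite inE/= in_itv/= andbT => r0.
  rewrite -EFinM -expRD -opprD -exponential_prob_tail ?addr_ge0// -EX//.
  rewrite /distribution /pushforward; congr (Q _).
  apply/seteqP; split => w /=; rewrite !in_itv/= !andbT;
    by rewrite lt_max ltrBrDl (ltNge r 0) r0 orbF.
rewrite ge0_integralZl ?integral_expRN ?oppr0 ?expR0 ?mule1//.
- exact: measurable_expRN.
Qed.

End exponential_calls.

(** * Approximation of convex functions from below by calls *)

Section convex_interpolation.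
Context {R : realType}.

(** Convexity cleared of denominators: the form is linear in the values of [phi] and covers
    coincident points. *)
Lemma convex_function_chord (phi : R -> R) (x y z : R) :
  convex_function (setT : set R^o) phi -> x <= y -> y <= z ->
  (z - x) * phi y <= (z - y) * phi x + (y - x) * phi z.
Proof.
move=> cphi xy yz; have [xz|] := ltP x z; last first.
  move=> zx; have -> : y = x by apply/le_anti; rewrite xy (le_trans yz).
  have -> : z = x by apply/le_anti; rewrite zx (le_trans xy).
  by rewrite subrr !mul0r addr0.
have zx0 : 0 < z - x by rewrite subr_gt0.
have t0 : 0 <= (z - y) / (z - x) by rewrite divr_ge0 ?subr_ge0// ltW.
have t1 : (z - y) / (z - x) <= 1 by rewrite ler_pdivrMr// mul1r lerD2l lerN2.
(* This is the weight for which y = t x + (1 - t) z. *)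
set t := (z - y) / (z - x) in t0 t1.
have h : phi (t * x + (1 - t) * z) <= t * phi x + (1 - t) * phi z.
  by apply: (cphi (Itv01 t0 t1)); rewrite inE.
have {h} : phi y <= t * phi x + (1 - t) * phi z.
  apply: le_trans h; rewrite le_eqVlt; apply/orP; left; apply/eqP; congr phi.
  by rewrite /t; field; rewrite gt_eqF.
rewrite -(ler_pM2l zx0) => /le_trans; apply.
rewrite le_eqVlt; apply/orP; left; apply/eqP.
by rewrite /t; field; rewrite gt_eqF.
Qed.

Variable psi : R -> R.
Hypothesis psi0 : psi 0 = 0.
Hypothesis psi_nd : forall x y, 0 <= x -> x <= y -> psi x <= psi y.
Hypothesis psi_chord : forall x y z, 0 <= x -> x <= y -> y <= z ->
  (z - x) * psi y <= (z - y) * psi x + (y - x) * psi z.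
Variable e : R.
Hypothesis e0 : 0 < e.

(* On [k e, (k + 1) e], with k <= N, mesh_calls N interpolates linearly between
   psi ((k - 1) e) and psi (k e): it is the chord interpolation of psi delayed by
   e, hence below psi.  As 0.-1 = 0, the slope of index 0 is 0. *)
Definition mesh_slope (j : nat) : R := (psi (j%:R * e) - psi (j.-1%:R * e)) / e.

Definition mesh_calls (N : nat) (x : R) : R :=
  \sum_(j < N) (mesh_slope j.+1 - mesh_slope j) * Num.max (x - j.+1%:R * e) 0.

Let mesh_ge0 (j : nat) : 0 <= j%:R * e. Proof. by rewrite mulr_ge0// ltW. Qed.

Let mesh_slopeE j : mesh_slope j * e = psi (j%:R * e) - psi (j.-1%:R * e).
Proof. by rewrite /mesh_slope divfK// gt_eqF. Qed.

Lemma mesh_slope_ge0 j : 0 <= mesh_slope j.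
Proof.
rewrite divr_ge0 ?(ltW e0)// subr_ge0 psi_nd// ler_wpM2r ?(ltW e0)// ler_nat.
exact: leq_pred.
Qed.

(** Convexity at three consecutive mesh points; at index 0 the slope is 0 and monotonicity of [psi]
    suffices. The coefficients of [mesh_calls] are thus nonnegative. *)
Lemma mesh_slope_nd j : mesh_slope j <= mesh_slope j.+1.
Proof.
case: j => [|j]; first by rewrite {1}/mesh_slope subrr mul0r mesh_slope_ge0.
rewrite -(ler_pM2r e0) !mesh_slopeE/=.
have := psi_chord (j%:R * e) (j.+1%:R * e) (j.+2%:R * e) (mesh_ge0 _).
rewrite !ler_wpM2r ?ler_nat ?(ltW e0)// => /(_ isT isT).
rewrite -(natr1 j.+1) -(natr1 j).
move: (psi _) (psi _) (psi _) => a b c.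
move=> h; rewrite -(ler_pM2l e0); lra.
Qed.

(** On the cell of index [k] the calls of index at least [k] vanish, the others are affine, and
    their slopes telescope. The case [k = N] covers the unbounded last piece. *)
Lemma mesh_callsE N k x : (k <= N)%N -> k%:R * e <= x ->
  (k = N \/ x <= k.+1%:R * e) ->
  mesh_calls N x = psi (k.-1%:R * e) + mesh_slope k * (x - k%:R * e).
Proof.
move=> kN kx kxN; rewrite /mesh_calls.
rewrite -(big_mkord xpredT
  (fun j => (mesh_slope j.+1 - mesh_slope j) * Num.max (x - j.+1%:R * e) 0)).
rewrite (big_cat_nat (leq0n k) kN)/= [X in _ + X]big1_seq ?addr0; last first.
  move=> j; rewrite mem_index_iota => /andP[_ /andP[kj jN]].
  case: kxN => [kN'|xk]; first by move: kj; rewrite kN' leqNgt jN.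
  rewrite max_r ?mulr0// subr_le0 (le_trans xk)// ler_wpM2r ?(ltW e0)//.
  by rewrite ler_nat.
transitivity (\sum_(0 <= j < k) (mesh_slope j.+1 - mesh_slope j) * (x - j.+1%:R * e)).
  apply: eq_big_nat => j /andP[_ jk]; rewrite max_l// subr_ge0.
  by rewrite (le_trans _ kx)// ler_wpM2r ?(ltW e0)// ler_nat.
(* Without the maxima this is an identity of affine functions, valid for every [x], so the cell can
   be forgotten before the induction. *)
elim: k {kN kx kxN} => [|k IH].
  by rewrite big_nil/= mul0r psi0 add0r /mesh_slope subrr !mul0r.
rewrite big_nat_recr//= IH.
have := mesh_slopeE k; rewrite -(natr1 k).
move: (mesh_slope _) (mesh_slope _) => s s' /eqP.
rewrite eq_sym subr_eq => /eqP ->; ring.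
Qed.

(** With k the smaller of N and the integer part of x / e, convexity at (k - 1) e, k e and x puts
    psi x above the line through the first two points, and the interpolation is that line lowered by
    psi (k e) - psi ((k - 1) e). *)
Lemma mesh_calls_le N x : 0 <= x -> mesh_calls N x <= psi x.
Proof.
move=> x0; have /andP[tx xt] := @truncn_itv _ (x / e) (divr_ge0 x0 (ltW e0)).
rewrite ler_pdivlMr// in tx; rewrite ltr_pdivrMr// in xt.
have [k [kN kx kxN]] : exists k, [/\ (k <= N)%N, k%:R * e <= x &
    k = N \/ x <= k.+1%:R * e].
  have [tN|Nt] := leqP (Num.truncn (x / e)) N.
    by exists (Num.truncn (x / e)); split => //; right; exact: ltW.
  exists N; split => //; last by left.
  by apply: le_trans tx; rewrite ler_wpM2r ?(ltW e0)// ler_nat ltnW.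
rewrite (mesh_callsE _ _ _ kN kx kxN) -(ler_pM2r e0) mulrDl mulrAC mesh_slopeE.
case: k kx {kN kxN} => [|k] kx.
  by rewrite /= subrr ?mul0r ?psi0 ?(mul0r, addr0) mulr_ge0 ?(ltW e0)// -psi0 psi_nd.
have := psi_chord (k%:R * e) (k.+1%:R * e) x (mesh_ge0 _).
rewrite ler_wpM2r ?ler_nat ?(ltW e0)// => /(_ isT kx) /=.
have : e * psi (k%:R * e) <= e * psi (k.+1%:R * e).
  by rewrite ler_wpM2l ?(ltW e0)// psi_nd// ler_wpM2r ?(ltW e0)// ler_nat.
rewrite -(natr1 k).
move: (psi _) (psi _) (psi _) => a b c; lra.
Qed.

(** The interpolation is at least [psi] at u = (k - 1) e (at u = 0 if k = 0), where x - u <= 2 e; by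
    convexity the slope of [psi] from u to x is at most the one from x to x + 1. *)
Lemma mesh_calls_ge N x : 0 <= x -> x < N.+1%:R * e ->
  psi x - 2 * e * (psi (x + 1) - psi x) <= mesh_calls N x.
Proof.
move=> x0 xN; have /andP[tx xt] := @truncn_itv _ (x / e) (divr_ge0 x0 (ltW e0)).
rewrite ler_pdivlMr// in tx; rewrite ltr_pdivrMr// in xt.
set k := Num.truncn (x / e) in tx xt.
have kN : (k <= N)%N.
  by rewrite -ltnS -(ltr_nat R) -(ltr_pM2r e0) (le_lt_trans tx).
rewrite (mesh_callsE _ _ _ kN tx); last by right; exact: ltW.
apply: (@le_trans _ _ (psi (k.-1%:R * e))); last first.
  by rewrite lerDl mulr_ge0 ?mesh_slope_ge0// subr_ge0.
have ux : k.-1%:R * e <= x.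
  by apply: le_trans tx; rewrite ler_wpM2r ?(ltW e0)// ler_nat leq_pred.
have xx1 : x <= x + 1 by rewrite lerDl.
have xu : x - k.-1%:R * e <= 2 * e.
  move: xt; case: (k) => [|m] /=; rewrite -?(natr1 m.+1) -?(natr1 m); nra.
have := psi_chord _ _ _ (mesh_ge0 k.-1) ux xx1.
have : (x - k.-1%:R * e) * (psi (x + 1) - psi x) <= 2 * e * (psi (x + 1) - psi x).
  by rewrite ler_wpM2r// subr_ge0 psi_nd.
lra.
Qed.

End convex_interpolation.

(** * From inequalities between calls to the convex order *)

Section convex_order.
Local Open Scope ereal_scope.

Lemma limn_einf_le {R : realType} (u : (\bar R)^nat) (M : \bar R) :
  (forall n, u n <= M) -> limn_einf u <= M.
Proof.
move=> uM; rewrite limn_einf_lim; apply: lime_le; first exact: is_cvg_einfs.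
apply: nearW => n; apply: le_trans (uM n).
by apply: ereal_inf_lbound; exists n => /=.
Qed.

(** Only an infinite integral of f needs an argument: the negative part of f + g is at most that of
    g, hence integrable, while f <= (f + g)^+ + g^- forces the positive part to have infinite
    integral. *)
Lemma ge0_integralD_integrable d (T : measurableType d) (R : realType)
    (mu : {measure set T -> \bar R}) (f g : T -> R) :
  measurable_fun setT f -> (forall x, (0 <= f x)%R) ->
  mu.-integrable setT (EFin \o g) ->
  \int[mu]_x (f x + g x)%:E = \int[mu]_x (f x)%:E + \int[mu]_x (g x)%:E.
Proof.
move=> mf f0 ig; have mEf : measurable_fun setT (EFin \o f) by exact/measurable_EFinP.
have /integrableP[mEg _] := ig.
have intf0 : 0 <= \int[mu]_x (f x)%:E by apply: integral_ge0 => x _; rewrite lee_fin.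
have [foo|foo] := ltP (\int[mu]_x (f x)%:E) +oo.
  rewrite -integralD//; apply/integrableP; split => //.
  by under eq_integral do rewrite gee0_abs ?lee_fin//.
have {foo}intf : \int[mu]_x (f x)%:E = +oo by apply/eqP; rewrite -leye_eq.
have gfin : \int[mu]_x (g x)%:E \is a fin_num by exact: integrable_fin_num.
have mfg : measurable_fun setT (fun x => (f x + g x)%:E).
  by apply/measurable_EFinP; apply: measurable_funD => //; exact/measurable_EFinP.
have gneg : \int[mu]_x (EFin \o g)^\- x < +oo.
  have /integrableP[_] := integrable_funeneg measurableT ig.
  by under eq_integral do rewrite gee0_abs ?funeneg_ge0//.
rewrite intf addye; last by move: gfin; rewrite fin_numE => /andP[].
have fgneg : \int[mu]_x (fun x => (f x + g x)%:E)^\- x < +oo.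
  apply: le_lt_trans gneg; apply: ge0_le_integral => //.
  - exact: measurable_funeneg.
  - exact: measurable_funeneg.
  - move=> x _; apply: (@funeneg_le _ _ setT) => [t _ /=|]; last by rewrite inE.
    by rewrite lee_fin lerDr.
have fgpos : \int[mu]_x (fun x => (f x + g x)%:E)^\+ x = +oo.
  apply/eqP; rewrite -leye_eq leNgt; apply/negP => pos.
  have : \int[mu]_x (f x)%:E < +oo.
    apply: (@le_lt_trans _ _
        (\int[mu]_x ((fun x => (f x + g x)%:E)^\+ x + (EFin \o g)^\- x))).
      apply: ge0_le_integral => //.
      - by move=> x _; rewrite lee_fin.
      - by apply: emeasurable_funD; [exact: measurable_funepos|exact: measurable_funeneg].
      - move=> x _; rewrite funeposE funenegE /= -!EFin_max -EFinD lee_fin.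
        by rewrite /Num.max; case: ifP; case: ifP; lra.
    rewrite ge0_integralD//; [|exact: measurable_funepos|exact: measurable_funeneg].
    exact: lte_add_pinfty.
  by rewrite intf.
rewrite integralE fgpos addye//.
by rewrite eqe_oppLR /= lt_eqF.
Qed.

Context {R : realType} {d d' : measure_display} {T : measurableType d}
  {T' : measurableType d'}.
Variables (P : probability T R) (Q : probability T' R).

(** Nonnegative coefficients allow termwise integration even when calls have infinite integral. *)
Lemma integral_mesh_calls d1 (U : measurableType d1) (mu : {measure set U -> \bar R})
    (X : U -> R) (psi : R -> R) (e : R) (N : nat) :
  measurable_fun setT X ->
  (forall j, mesh_slope psi e j <= mesh_slope psi e j.+1)%R ->
  \int[mu]_w (mesh_calls psi e N (X w))%:E =
  \sum_(j < N) (mesh_slope psi e j.+1 - mesh_slope psi e j)%:E *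
    \int[mu]_w (Num.max (X w - j.+1%:R * e) 0)%:E.
Proof.
move=> mX nd.
have mcall a : measurable_fun setT (fun w => (Num.max (X w - a) 0)%:E).
  by apply/measurable_EFinP; apply: measurable_maxr => //; exact: measurable_funB.
under eq_integral do rewrite /mesh_calls -sumEFin.
rewrite ge0_integral_sum//.
- apply: eq_bigr => j _; under eq_integral do rewrite EFinM.
  rewrite ge0_integralZl_EFin ?subr_ge0//.
  by move=> w _; rewrite lee_fin le_max lexx orbT.
- by move=> j; under eq_fun do rewrite EFinM; exact: measurable_funeM.
- move=> j w _; rewrite lee_fin mulr_ge0 ?subr_ge0//.
  by rewrite le_max lexx orbT.
Qed.

Local Open Scope ring_scope.

(** The mesh 1 / (n + 1) tends to 0, while (n + 1)^2 calls reach up to n + 1 and so eventually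
    beyond x; the two bounds on [mesh_calls] then squeeze. *)
Lemma mesh_calls_cvg (psi : R -> R) (x : R) : psi 0 = 0 ->
  (forall x y, 0 <= x -> x <= y -> psi x <= psi y) ->
  (forall x y z, 0 <= x -> x <= y -> y <= z ->
    (z - x) * psi y <= (z - y) * psi x + (y - x) * psi z) ->
  0 <= x ->
  mesh_calls psi n.+1%:R^-1 (n.+1 * n.+1) x @[n --> \oo] --> psi x.
Proof.
move=> psi0 psi_nd psi_chord x0.
have e0 (n : nat) : 0 < n.+1%:R^-1 :> R by rewrite invr_gt0.
apply: (@squeeze_cvgr _ _ _ _
    (fun n => psi x - 2 * n.+1%:R^-1 * (psi (x + 1) - psi x)) (cst (psi x))).
- near=> n; apply/andP; split; last exact: mesh_calls_le.
  apply: mesh_calls_ge => //; rewrite -natr1 natrM mulrDl mulfK ?pnatr_eq0//.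
  rewrite (@lt_le_trans _ _ n.+1%:R)// ?lerDl ?(ltW (e0 n))//.
  rewrite (@lt_trans _ _ n%:R)// ?ltr_nat//.
  by near: n; exact: nbhs_infty_gtr.
- rewrite -[X in _ --> X]subr0; apply: cvgB; first exact: cvg_cst.
  rewrite -[X in _ --> X](mul0r (psi (x + 1) - psi x)); apply: cvgMl.
  rewrite -[X in _ --> X](mulr0 2); apply: cvgMr.
  exact: cvg_harmonic.
- exact: cvg_cst.
Unshelve. all: by end_near. Qed.

(* Equality of the means takes care of the affine part of a convex function: after
   subtracting a chord at 0 the function is nondecreasing on [0, +oo[. *)
Lemma convex_dominated_of_calls (X : T -> R) (Y : T' -> R) :
  measurable_fun setT X -> measurable_fun setT Y ->
  (forall w, 0 <= X w) -> (forall w, 0 <= Y w) ->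
  ('E_P[X] = 'E_Q[Y])%E -> ('E_Q[Y] < +oo)%E ->
  (forall a, 0 <= a -> ('E_P[fun w => Num.max (X w - a)%R 0%R] <=
                        'E_Q[fun w => Num.max (Y w - a)%R 0%R])%E) ->
  convex_dominated P X Q Y.
Proof.
move=> mX mY X0 Y0 EXY EYoo calls phi cphi.
(* The slope of [phi] on [-1, 0]: [psi] then vanishes at -1 and 0, and chords starting at -1 show
   that it is nonnegative and nondecreasing on [0, +oo[. *)
pose p := phi 0 - phi (-1).
pose psi x := phi x - (phi 0 + p * x).
have psi0 : psi 0 = 0 by rewrite /psi; lra.
have psi_chord x y z : x <= y -> y <= z ->
    (z - x) * psi y <= (z - y) * psi x + (y - x) * psi z.
  by move=> xy yz; have := convex_function_chord phi x y z cphi xy yz; rewrite /psi; lra.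
have psiN1 : psi (-1) = 0 by rewrite /psi /p; lra.
have psi_ge0 x : 0 <= x -> 0 <= psi x.
  move=> x0; have := psi_chord (-1) 0 x; rewrite psi0 psiN1 (lerN10 R) => /(_ isT x0).
  by lra.
have psi_nd x y : 0 <= x -> x <= y -> psi x <= psi y.
  move=> x0 xy; have := psi_chord (-1) x y; rewrite psiN1 (le_trans (lerN10 R) x0).
  move=> /(_ isT xy) chord; have y0 := le_trans x0 xy.
  have y1 : 0 < y + 1 by rewrite ltr_wpDl.
  have : 0 <= (y - x) * psi y by apply: mulr_ge0; [rewrite subr_ge0|exact: psi_ge0].
  by rewrite -[psi x <= _](ler_pM2l y1); lra.
have {}psi_chord x y z : 0 <= x -> x <= y -> y <= z ->
  (z - x) * psi y <= (z - y) * psi x + (y - x) * psi z by move=> _; exact: psi_chord.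
have e_gt0 (n : nat) : 0 < n.+1%:R^-1 :> R by rewrite invr_gt0.
have slope_nd n j := mesh_slope_nd psi psi_nd psi_chord n.+1%:R^-1 (e_gt0 n) j.
have cvgX w := mesh_calls_cvg psi (X w) psi0 psi_nd psi_chord (X0 w).
have cvgY w := mesh_calls_cvg psi (Y w) psi0 psi_nd psi_chord (Y0 w).
have mmesh d1 (U : measurableType d1) (Z : U -> R) n : measurable_fun setT Z ->
    measurable_fun setT (fun w => mesh_calls psi n.+1%:R^-1 (n.+1 * n.+1) (Z w)).
  move=> mZ; apply: measurable_sum => j; apply: measurable_funM => //.
  by apply: measurable_maxr => //; exact: measurable_funB.
have mesh_ge0 n x : 0 <= mesh_calls psi n.+1%:R^-1 (n.+1 * n.+1) x.
  apply: sumr_ge0 => j _; rewrite mulr_ge0 ?subr_ge0 ?slope_nd//.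
  by rewrite le_max lexx orbT.
(* Measurability comes from the pointwise limit of the mesh functions. *)
have mpsiX : measurable_fun setT (psi \o X).
  by apply: measurable_fun_cvg => [n|w _]; [exact: (mmesh _ _ X n mX)|exact: cvgX].
have mpsiY : measurable_fun setT (psi \o Y).
  by apply: measurable_fun_cvg => [n|w _]; [exact: (mmesh _ _ Y n mY)|exact: cvgY].
(* Fatou's lemma for X, then comparison call by call, then [mesh_calls] below [psi] for Y. *)
have psiXY : (\int[P]_w (psi (X w))%:E <= \int[Q]_w (psi (Y w))%:E)%E.
  pose f n w := (mesh_calls psi n.+1%:R^-1 (n.+1 * n.+1) (X w))%:E.
  rewrite (_ : \int[P]_w _ = \int[P]_w limn_einf (f ^~ w))%E; last first.
    apply: eq_integral => w _; apply/esym; apply: (cvg_limn_einf_sup _).1.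
    by apply: cvg_EFin; [exact: nearW|exact: cvgX].
  apply: le_trans (fatou P measurableT _ _) _.
  - by move=> n; apply/measurable_EFinP; exact: mmesh.
  - by move=> n w _; rewrite lee_fin mesh_ge0.
  apply: limn_einf_le => n.
  apply: (@le_trans _ _ (\int[Q]_w
      (mesh_calls psi n.+1%:R^-1 (n.+1 * n.+1) (Y w))%:E)%E).
    rewrite /f !integral_mesh_calls//; apply: lee_sum => j _.
    rewrite lee_wpmul2l ?lee_fin ?subr_ge0//.
    have := calls (j.+1%:R * n.+1%:R^-1); rewrite unlock; apply.
    by rewrite mulr_ge0// ltW.
  apply: ge0_le_integral => //.
  - by move=> w _; rewrite lee_fin mesh_ge0.
  - by apply/measurable_EFinP; exact: mmesh.
  - exact/measurable_EFinP.
  - move=> w _; rewrite lee_fin; apply: mesh_calls_le => //.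
(* The affine part has the same finite expectation for both variables, so only the possibly infinite
   integrals of [psi] remain to be compared. *)
have split_affine d1 (U : measurableType d1) (mu : probability U R) (Z : U -> R) :
    measurable_fun setT Z -> (forall w, 0 <= Z w) -> measurable_fun setT (psi \o Z) ->
    ('E_mu[Z] < +oo)%E ->
    ('E_mu[phi \o Z] = \int[mu]_w (psi (Z w))%:E + ((phi 0)%:E + p%:E * 'E_mu[Z]))%E.
  move=> mZ Z0 mpsiZ; rewrite unlock => EZ.
  have iZ : mu.-integrable setT (EFin \o Z).
    apply/integrableP; split; first exact/measurable_EFinP.
    by under eq_integral do rewrite gee0_abs ?lee_fin//.
  have ic : mu.-integrable setT (fun=> (phi 0)%:E).
    exact: finite_measure_integrable_cst.
  have ipZ := integrableZl measurableT p iZ.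
  transitivity (\int[mu]_w (psi (Z w) + (phi 0 + p * Z w))%:E)%E.
    by apply: eq_integral => w _; rewrite /psi /= subrK.
  rewrite ge0_integralD_integrable//; last 2 first.
  - by move=> w; exact: psi_ge0.
  - by apply: eq_integrable (integrableD measurableT ic ipZ).
  congr (_ + _)%E; under eq_integral do rewrite EFinD EFinM.
  rewrite integralD// integralZl// integral_cst//.
  by rewrite [X in (_ * X)%E](@probability_setT _ _ _ mu) mule1.
rewrite (split_affine _ _ P X)// ?EXY// (split_affine _ _ Q Y)//.
by rewrite leeD2r.
Qed.


End convex_order.

(** * Exponential decay of calls from the tail bound *)

Section call_decay.
Context {R : realType} {d : measure_display} {T : measurableType d}.
Variables (P : probability T R) (X : T -> R).
Hypothesis mX : measurable_fun setT X.
Hypothesis X0 : forall w, 0 <= X w.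
Hypothesis EX : ('E_P[X] = 1)%E.
Hypothesis call_le_tail : forall a, 0 <= a ->
  ('E_P[fun w => Num.max (X w - a)%R 0%R] <= P [set w | (a < X w)%R])%E.

Let G a : \bar R := ('E_P[fun w => Num.max (X w - a)%R 0%R])%E.

Let mcall a : measurable_fun setT (fun w => Num.max (X w - a) 0).
Proof. by apply: measurable_maxr => //; exact: measurable_funB. Qed.

Let mtail a : measurable [set w | a < X w].
Proof.
rewrite (_ : [set w | _] = X @^-1` `]a, +oo[%classic).
  by rewrite -[X in measurable X]setTI; apply: mX.
by apply/seteqP; split => w /=; rewrite in_itv/= andbT.
Qed.

Let G_ge0 a : (0 <= G a)%E.
Proof. by apply: expectation_ge0 => w; rewrite le_max lexx orbT. Qed.

Let G0 : G 0 = 1%E.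
Proof.
rewrite /G -EX; congr ('E_P[_])%E; apply/funext => w.
by rewrite subr0 max_l.
Qed.

Let G_fin a : 0 <= a -> G a \is a fin_num.
Proof.
move=> a0; rewrite ge0_fin_numE ?G_ge0//.
by apply: le_lt_trans (call_le_tail a a0) _; rewrite ltey_eq fin_num_measure.
Qed.

Let G_step a e : 0 <= a -> 0 <= e ->
  (1 + e) * fine (G (a + e)) <= fine (G a).
Proof.
move=> a0 e0; have ae0 : 0 <= a + e by rewrite addr_ge0.
rewrite -lee_fin EFinM !fineK ?G_fin// EFinD ge0_muleDl ?lee_fin// mul1e.
apply: (@le_trans _ _ (G (a + e) + e%:E * P [set w | (a + e < X w)%R])%E).
  by rewrite leeD2l// lee_wpmul2l ?lee_fin// call_le_tail.
have mI : measurable_fun setT (fun w => (\1_[set w | a + e < X w] w : R)%:E).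
  by apply/measurable_EFinP; exact: measurable_indic.
have mC b : measurable_fun setT (fun w => (Num.max (X w - b) 0)%:E).
  exact/measurable_EFinP.
have C0 b w : (0 <= (Num.max (X w - b)%R 0%R)%:E)%E.
  by rewrite lee_fin le_max lexx orbT.
have I0 w : (0 <= (\1_[set w | (a + e < X w)%R] w : R)%:E)%E by rewrite lee_fin.
rewrite /G unlock -[X in P X]setIT -integral_indic//.
rewrite -ge0_integralZl_EFin// -ge0_integralD//; last 2 first.
- by move=> w _; rewrite mule_ge0.
- exact: measurable_funeM.
apply: ge0_le_integral => //.
- by move=> w _; rewrite adde_ge0 ?mule_ge0.
- by apply: emeasurable_funD => //; exact: measurable_funeM.
- move=> w _; rewrite -EFinM -EFinD lee_fin indicE.
  have [/set_mem /= aX|/negP aX] := boolP (w \in _).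
    by rewrite mulr1 !max_l; lra.
  rewrite mulr0 addr0 ge_max !le_max lexx orbT andbT; apply/orP; left; lra.
Qed.

Let G_iter a n : 0 <= a -> (1 + a) ^+ n * fine (G (a *+ n)) <= 1.
Proof.
move=> a0; elim: n => [|n IH]; first by rewrite expr0 mul1r mulr0n G0.
apply: le_trans IH; rewrite exprSr -mulrA ler_wpM2l ?exprn_ge0 ?addr_ge0//.
by rewrite mulrSr G_step// mulrn_wge0.
Qed.

Lemma call_decay a : 0 <= a ->
  ('E_P[fun w => Num.max (X w - a)%R 0%R] <= (expR (- a))%:E)%E.
Proof.
move=> a0; rewrite -[leLHS](fineK (G_fin a a0)) lee_fin expRN.
rewrite -div1r ler_pdivlMr ?expR_gt0//.
(* With y = a / (n + 1), the iterated bound has the factor (1 + y)^(n + 1), which is at least exp (y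
   / (1 + y))^(n + 1) = exp (a / (1 + y)); this tends to exp a. *)
have bound n : fine (G a) * expR (a / (1 + a * n.+1%:R^-1)) <= 1.
  set y := a * n.+1%:R^-1.
  have y0 : 0 <= y by rewrite mulr_ge0.
  have y1 : 0 < 1 + y by rewrite ltr_pwDl.
  (* The inverse of exp (- u) >= 1 - u at u = y / (1 + y), where 1 - u = 1 / (1 + y). *)
  have ey : expR (y / (1 + y)) <= 1 + y.
    rewrite -[leLHS]invrK -expRN -[leRHS]invrK lef_pV2 ?posrE ?invr_gt0 ?expR_gt0//.
    apply: le_trans (expR_ge1Dx _); rewrite le_eqVlt; apply/orP; left; apply/eqP.
    by field; rewrite gt_eqF.
  have := G_iter y n.+1 y0; rewrite (_ : y *+ n.+1 = a); last first.
    by rewrite -mulr_natr /y mulfVK// pnatr_eq0.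
  apply: le_trans; rewrite mulrC ler_wpM2r ?fine_ge0//.
  rewrite (_ : a / (1 + y) = n.+1%:R * (y / (1 + y))); last first.
    by rewrite mulrA; congr (_ / _); rewrite /y mulrCA divff ?mulr1// pnatr_eq0.
  by rewrite expRM_natl lerXn2r// nnegrE ?expR_ge0// ltW.
have cv : fine (G a) * expR (a / (1 + a * n.+1%:R^-1)) @[n --> \oo] -->
    fine (G a) * expR a.
  apply: cvgMr; apply: continuous_cvg; first exact: continuous_expR.
  rewrite -[X in _ --> X]mulr1; apply: cvgMr.
  rewrite -[X in _ --> X]invr1; apply: cvgV; first exact: oner_neq0.
  rewrite -[X in _ --> X]addr0; apply: cvgD; first exact: cvg_cst.
  rewrite -[X in _ --> X](mulr0 a); apply: cvgMr; exact: cvg_harmonic.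
rewrite -(cvg_lim _ cv)//; apply: limr_le; first exact: cvgP cv.
exact: nearW.
Qed.

End call_decay.

(** * The total mass of the dual previsible projection *)

Lemma call_le_ereal {R : realType} (r a : R) (m : \bar R) :
  (0 <= m)%E -> (r%:E <= m + a%:E)%E -> ((Num.max (r - a) 0)%:E <= m)%E.
Proof. by move=> m0 rm; rewrite /Num.max; case: ifP => // _; rewrite EFinB leeBlDr. Qed.

Section compensator.
Context {R : realType} {d : measure_display} {Omega : measurableType d}.
Variables (P : probability Omega R) (F : R -> set (set Omega)).
Variables A Ap : R -> Omega -> R.
Hypothesis A_path : forall w, increasing_path (A ^~ w).
Hypothesis A_infty : forall w, A t w @[t --> +oo] --> (1 : R).
Hypothesis F_measurable : forall t, 0 <= t -> F t `<=` measurable.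
Hypothesis Ap_proj : dual_previsible_projection P F A Ap.

Let previsible_Ap : previsible F Ap. Proof. by case: Ap_proj. Qed.
Let Ap_path : {ae P, forall w, increasing_path (Ap ^~ w)}.
Proof. by case: Ap_proj. Qed.

Let stieltjesA w : stieltjes (A ^~ w) `]0, +oo[%classic = 1%E.
Proof.
apply: cvg_unique (stieltjes_itv_oy _ (A_path w)) _ => //.
apply: cvg_EFin; first exact: nearW.
apply: cvg_comp (A_infty w).
by rewrite (cvg_shiftS (fun n => n%:R : R)); exact: cvgr_idn.
Qed.

Let L w := path_sup (Ap ^~ w).

Let mL : measurable_fun setT L.
Proof.
apply: measurable_fun_esups => n; apply/measurable_EFinP.
apply: measurableT_comp => //; apply: previsible_measurable previsible_Ap _ => //.
exact: F_measurable.
Qed.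

(** The test process 1 equates the mean total masses of [Ap] and [A], and the latter is 1 on every
    path. *)
Let integral_L : (\int[P]_w L w = 1)%E.
Proof.
have one_prev : previsible F (fun _ _ => 1 : R).
  by apply: (previsible_comp F Ap (cst 1)) => //; exact: measurable_cst.
have one_bounded : bounded_process (fun (_ : R) (_ : Omega) => 1 : R).
  by exists 1 => t w _; rewrite normr1.
have [_ _ /(_ _ one_prev one_bounded)] := Ap_proj; rewrite /mean_integral.
have int1 f : (\int[stieltjes f]_(t in `]0%R, +oo[) (1%:E) =
    stieltjes f `]0%R, +oo[%classic)%E.
  by rewrite integral_cst//= mul1e.
under eq_integral do rewrite int1.
under [in RHS]eq_integral do rewrite int1 stieltjesA.
rewrite integral_cst//= mul1e => LA; rewrite -(@probability_setT _ _ _ P) -LA.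
apply: ge0_ae_eq_integral_nonmeasurable => //.
- by move=> w; exact: path_sup_ge0.
- by apply: filterS Ap_path => w /stieltjes_path_sup.
Qed.

Let L_fin : {ae P, forall w, L w \is a fin_num}.
Proof.
have iL : P.-integrable setT L.
  apply/integrableP; split => //; under eq_integral do rewrite gee0_abs ?path_sup_ge0//.
  by rewrite integral_L ltry.
by apply: filterS (integrable_ae measurableT iL) => w; exact.
Qed.

(** A version of the terminal value that is measurable and nonnegative at every point; [fine] makes
    it 0 where the supremum is infinite. *)
Definition total_compensator w : R := fine (path_sup (Ap ^~ w)).

Lemma total_compensator_ge0 w : 0 <= total_compensator w.
Proof. by rewrite fine_ge0// path_sup_ge0. Qed.

Lemma measurable_total_compensator : measurable_fun setT total_compensator.
Proof. by apply: measurableT_comp mL => //. Qed.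

Lemma terminal_value_ae :
  {ae P, forall w, terminal_value Ap w = total_compensator w}.
Proof.
apply: filterS2 Ap_path L_fin => w pw fw.
apply: cvg_lim => //; apply: (cvg_path_sup (Ap ^~ w) pw).
by rewrite ltey_eq fw.
Qed.

Lemma expectation_total_compensator : ('E_P[total_compensator] = 1)%E.
Proof.
rewrite unlock -integral_L; apply: ge0_ae_eq_integral_nonmeasurable.
- by move=> w; rewrite lee_fin total_compensator_ge0.
- by move=> w; exact: path_sup_ge0.
- by apply: filterS L_fin => w fw; rewrite fineK.
Qed.

Lemma call_total_compensator a : 0 <= a ->
  ('E_P[fun w => Num.max (total_compensator w - a)%R 0%R] <=
   P [set w | (a < total_compensator w)%R])%E.
Proof.
move=> a0.
pose H t w : R := \1_(`]a, +oo[%classic : set R) (Ap t w).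
have H_prev : previsible F H.
  by apply: (previsible_comp F Ap (\1_(`]a, +oo[%classic))).
have H_bounded : bounded_process H.
  by exists 1 => t w _; rewrite /H indicE; case: (_ \in _); rewrite ?normr1 ?normr0.
have [_ _ /(_ _ H_prev H_bounded) HA] := Ap_proj.
have mB : measurable [set w | a < total_compensator w].
  rewrite (_ : [set w | _] = total_compensator @^-1` `]a, +oo[%classic).
    by rewrite -[X in measurable X]setTI; apply: measurable_total_compensator.
  by apply/seteqP; split => w /=; rewrite in_itv/= andbT.
have intH (mu : {measure set (measurableTypeR R) -> \bar R}) w :
    increasing_path (Ap ^~ w) -> (\int[mu]_(t in `]0%R, +oo[) (H t w)%:E =
    mu ([set t : measurableTypeR R | (a < Ap t w)%R] `&` `]0%R, +oo[%classic))%E.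
  exact: integral_superlevel.
(* Almost surely, the call is at most the mass that the path of [Ap] gives to its own superlevel
   set. *)
apply: (@le_trans _ _ (mean_integral P H Ap)).
  move=> {HA}; rewrite unlock; apply: ge0_ae_le_integral_nonmeasurable.
  - by move=> w; rewrite lee_fin le_max lexx orbT.
  - by move=> w; apply: integral_ge0 => t _; rewrite lee_fin.
  - apply: filterS2 Ap_path L_fin => w pw fw; rewrite (intH _ _ pw).
    apply: call_le_ereal; first exact: measure_ge0.
    rewrite /total_compensator (fineK fw).
    exact (path_sup_le_superlevel _ a pw a0).
(* After passing to [A], the inner integral is at most the total mass 1 on the event, and 0 off it,
   since a path with supremum at most [a] has an empty superlevel set. *)
rewrite {}HA -[X in P X]setIT -integral_indic//.
apply: ge0_ae_le_integral_nonmeasurable.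
- by move=> w; apply: integral_ge0 => t _; rewrite lee_fin.
- by move=> w; rewrite lee_fin.
apply: filterS2 Ap_path L_fin => w pw fw; rewrite (intH _ _ pw).
rewrite indicE; have [_|/negP wB] := boolP (w \in _).
  rewrite -(stieltjesA w) le_measure ?inE//; first exact: measurable_superlevel.
rewrite (_ : _ `&` _ = set0) ?measure0//.
apply/seteqP; split => // t [/= at0]; rewrite in_itv/= andbT => t0.
apply: wB; rewrite inE/=; apply: lt_le_trans at0 _.
by rewrite -lee_fin fineK// path_sup_ub// ltW.
Qed.

End compensator.

(** * Comparison with the exponential variable *)

Theorem theorem2 (R : realType)
    (d : measure_display) (Omega : measurableType d) (P : probability Omega R)
    (A : R -> Omega -> R)
    (A_measurable : forall t : R, 0 <= t -> measurable_fun setT (A t))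
    (A_path : forall w, increasing_path (A ^~ w))
    (A_infty : forall w, A t w @[t --> +oo] --> (1 : R))
    (F : R -> set (set Omega)) (F_filtration : right_continuous_filtration F)
    (Ap : R -> Omega -> R) (Ap_proj : dual_previsible_projection P F A Ap)
    (d' : measure_display) (Omega' : measurableType d')
    (P' : probability Omega' R) (E : {RV P' >-> R})
    (E_exp : exponential_mean_one E) :
  convex_dominated P (terminal_value Ap) P' E.
Proof.
have [_ F_measurable _ _] := F_filtration.
(* [E] is nonnegative only almost surely, whereas the comparison by calls asks for it everywhere;
   the positive part has the same calls at [a >= 0]. *)
pose E' w := Num.max (E w) 0.
have mE' : measurable_fun setT E' by exact: measurable_maxr.
have E'0 w : 0 <= E' w by rewrite le_max lexx orbT.
have call_E' a : 0 <= a -> ('E_P'[fun w => Num.max (E' w - a)%R 0%R] = (expR (- a))%:E)%E.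
  move=> a0; rewrite -(exponential_call _ _ _ _ _ E_exp a0); congr ('E_P'[_])%E.
  apply/funext => w; rewrite /E'; have [//|Ew] := leP 0 (E w).
  by rewrite !max_r//; lra.
have EE' : ('E_P'[E'] = 1)%E.
  rewrite -expR0 -oppr0 -(call_E' 0)//; congr ('E_P'[_])%E.
  by apply/funext => w; rewrite subr0 max_l.
have calls a : 0 <= a ->
    ('E_P[fun w => Num.max (total_compensator Ap w - a)%R 0%R] <=
     'E_P'[fun w => Num.max (E' w - a)%R 0%R])%E.
  move=> a0; rewrite call_E'//; apply: call_decay => //.
  - exact: (measurable_total_compensator P F A).
  - exact: total_compensator_ge0.
  - exact: (expectation_total_compensator P F A).
  - exact: (call_total_compensator P F A).
have dom : convex_dominated P (total_compensator Ap) P' E'.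
  apply: convex_dominated_of_calls => //.
  - exact: (measurable_total_compensator P F A).
  - exact: total_compensator_ge0.
  - by rewrite EE'; exact: (expectation_total_compensator P F A).
  - by rewrite EE' ltry.
move=> phi cphi.
have -> : ('E_P[phi \o terminal_value Ap] = 'E_P[phi \o total_compensator Ap])%E.
  rewrite unlock; apply: ae_eq_integral_nonmeasurable.
  have := terminal_value_ae P F A Ap A_path A_infty F_measurable Ap_proj.
  by apply: filterS => w /= ->.
have -> : ('E_P'[phi \o E] = 'E_P'[phi \o E'])%E; last exact: dom.
rewrite unlock; apply: ae_eq_integral_nonmeasurable.
(* [E] and [E'] differ only where [E] is negative, a null event since the exponential density
   vanishes there. *)
exists (E @^-1` `]-oo, 0[%classic); split.
- by rewrite -[X in measurable X]setTI; apply: measurable_funPT.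
- transitivity (exponential_prob 1 (`]-oo, 0[%classic : set R)).
    exact: (E_exp _ (measurable_itv _)).
  rewrite /exponential_prob integral0_eq// => t /=; rewrite in_itv/= => t0.
  by rewrite lt0_exponential_pdf.
- move=> w /= Ew; rewrite in_itv/= ltNge; apply/negP => Ew0.
  by apply: Ew; rewrite /E' max_l.
Qed.
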